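(* Let $R$ be an ordinary ring and let $a,b$ be integers. A complex of $R$-modules has projective amplitude in $[a,b]$ if and only if it is $(a-1)$-connected and $b$-skeletal.
   Context: Complexes (homologically graded) are considered as objects of the derived category of $R$. A complex has projective amplitude in $[a,b]$ if it is equivalent (quasi-isomorphic) to a complex of projective $R$-modules concentrated in degrees $a$ through $b$. A map $X\to Y$ in the derived category is $k$-connected if it is an isomorphism on $H_j$ for $j<k$ and surjective on $H_k$; an object $A$ is $k$-connected if $0\to A$ is $k$-connected, i.e. $H_j(A)=0$ for $j\le k$. An object $A$ is $k$-skeletal if for every $k$-connected map $X\to Y$, every map $A\to Y$ in the derived category lifts to a map $A\to X$. *)

(* Defs.v *)
From HB Require Import structures.
From mathcomp Require Import all_boot all_order all_algebra.
From mathcomp Require Import boolp classical_sets.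

Set Implicit Arguments.
Unset Strict Implicit.
Unset Printing Implicit Defensive.

Import GRing.Theory.
Import Quotient.
Local Open Scope ring_scope.
Local Open Scope quotient_scope.

(* Left modules over an arbitrary, possibly trivial, possibly noncommutative
   ring. The choice structure carried by [lmodType] is no restriction, since
   every type has one classically. *)
Definition projective (R : pzRingType) (P : lmodType R) : Prop :=
  forall (M N : lmodType R) (e : {linear M -> N}) (f : {linear P -> N}),
    (forall y, exists x, e x = y) ->
    exists g : {linear P -> M}, forall x, e (g x) = f x.

(* Only the components [cpx_d (n + 1) n] of the differential carry information;
   indexing it by a source and a target avoids transport along equalities such
   as (n + 1) - 1 = n. *)
Record complex (R : pzRingType) := Complex {
  cpx_mod :> int -> lmodType R;
  cpx_d : forall i j : int, {linear cpx_mod i -> cpx_mod j};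
  cpx_shape : forall i j, i <> j + 1 -> forall x, cpx_d i j x = 0;
  cpx_dd : forall i j k x, cpx_d j k (cpx_d i j x) = 0
}.
Arguments cpx_d {R} c i j.

Record chain_map (R : pzRingType) (X Y : complex R) := ChainMap {
  cm_fun :> forall n : int, {linear X n -> Y n};
  cm_comm : forall i j x, cm_fun j (cpx_d X i j x) = cpx_d Y i j (cm_fun i x)
}.

Section ChainMaps.
Context {R : pzRingType}.
Implicit Types X Y Z : complex R.

Definition chain_id X : chain_map X X :=
  @ChainMap R X X (fun n => idfun) (fun _ _ _ => erefl).

Lemma chain_comp_comm X Y Z (g : chain_map Y Z) (f : chain_map X Y) i j x :
  (g j \o f j) (cpx_d X i j x) = cpx_d Z i j ((g i \o f i) x).
Proof. by rewrite /= !cm_comm. Qed.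

Definition chain_comp X Y Z (g : chain_map Y Z) (f : chain_map X Y) :
  chain_map X Z := @ChainMap R X Z (fun n => g n \o f n) (chain_comp_comm g f).

Definition zero_complex : complex R :=
  @Complex R (fun _ => 'rV[R]_0) (fun _ _ => \0) (fun _ _ _ _ => erefl)
    (fun _ _ _ _ => erefl).

Lemma chain_zero_comm X Y i j (x : X i) :
  (\0 : {linear X j -> Y j}) (cpx_d X i j x) = cpx_d Y i j ((\0 : {linear X i -> Y i}) x).
Proof. by rewrite /= linear0. Qed.

Definition chain_zero X Y : chain_map X Y :=
  @ChainMap R X Y (fun n => \0) (@chain_zero_comm X Y).

End ChainMaps.

Section Homology.
Context {R : pzRingType}.
Implicit Types X Y : complex R.

Section Modules.
Variables (X : complex R) (n : int).

Definition is_cycle : {pred X n} := fun z => cpx_d X n (n - 1) z == 0.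

Fact is_cycle_submod : subsemimod_closed is_cycle.
Proof.
split=> [|c z]; first split=> [|z w]; rewrite !unfold_in /is_cycle ?linear0 //.
  by rewrite linearD => /eqP-> /eqP->; rewrite addr0.
by rewrite linearZ /= => /eqP->; rewrite scaler0.
Qed.

Record cycles : predArgType := Cycle { cycle_val : X n; _ : is_cycle cycle_val }.

HB.instance Definition _ := [isSub for cycle_val].
HB.instance Definition _ := [Choice of cycles by <:].
HB.instance Definition _ :=
  GRing.SubChoice_isSubLmodule.Build R (X n) is_cycle cycles is_cycle_submod.

Definition is_boundary : {pred cycles} :=
  fun z => `[< exists x : X (n + 1), cpx_d X (n + 1) n x = cycle_val z >].

Fact is_boundary_submod : subsemimod_closed is_boundary.
Proof.
split=> [|c z]; first split=> [|z w]; rewrite !unfold_in.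
- by apply/asboolP; exists 0; rewrite linear0.
- move=> /asboolP[x dx] /asboolP[y dy]; apply/asboolP.
  by exists (x + y); rewrite linearD dx dy.
- move=> /asboolP[x dx]; apply/asboolP.
  by exists (c *: x); rewrite linearZ dx.
Qed.

HB.instance Definition _ :=
  GRing.isSubmodClosed.Build R cycles is_boundary is_boundary_submod.

Definition homology : Type := {quot is_boundary}.
HB.instance Definition _ := GRing.Zmodule.on homology.

Definition hclass (z : cycles) : homology := \pi_{quot is_boundary} z.

Lemma hclass_eq z w : (hclass z = hclass w) <-> (z - w \in is_boundary).
Proof. by rewrite (idealrBE _ z w); split=> /eqP. Qed.

Lemma hclassK (h : homology) : hclass (repr h) = h.
Proof. exact: reprK. Qed.

Definition hscale (c : R) (h : homology) : homology := hclass (c *: repr h).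

Lemma hclassD : {morph hclass : z w / z + w}.
Proof. by move=> z w; rewrite /hclass piE. Qed.

Lemma hclassZ c z : hscale c (hclass z) = hclass (c *: z).
Proof.
apply/hclass_eq; rewrite -scalerBr rpredZ //; apply/hclass_eq; exact: hclassK.
Qed.

Fact hscaleA a b h : hscale a (hscale b h) = hscale (a * b) h.
Proof. by rewrite -[h]hclassK !hclassZ scalerA. Qed.
Fact hscale1 : left_id 1 hscale.
Proof. by move=> h; rewrite -[h]hclassK hclassZ scale1r. Qed.
Fact hscaleDr : right_distributive hscale +%R.
Proof.
move=> c g h; rewrite -[g]hclassK -[h]hclassK -hclassD !hclassZ.
by rewrite scalerDr hclassD.
Qed.
Fact hscaleDl h : {morph hscale^~ h : a b / a + b}.
Proof. by move=> a b; rewrite -[h]hclassK !hclassZ scalerDl hclassD. Qed.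

HB.instance Definition _ :=
  GRing.Zmodule_isLmodule.Build R homology hscaleA hscale1 hscaleDr hscaleDl.

End Modules.

Section Functor.
Variables (X Y : complex R) (f : chain_map X Y) (n : int).

Fact cycle_map_subproof (z : cycles X n) :
  is_cycle (f n (cycle_val z)).
Proof. by case: z => z /= /eqP dz; rewrite /is_cycle -cm_comm dz linear0. Qed.

Definition cycle_map (z : cycles X n) : cycles Y n :=
  Cycle (cycle_map_subproof z).

Definition hmap (h : homology X n) : homology Y n := hclass (cycle_map (repr h)).

Lemma hmapE z : hmap (hclass z) = hclass (cycle_map z).
Proof.
apply/hclass_eq; have /hclass_eq/asboolP[x dx] := hclassK (hclass z).
by apply/asboolP; exists (f (n + 1) x); rewrite -cm_comm dx linearB.
Qed.

Fact hmap_is_linear : linear hmap.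
Proof.
move=> c g h; rewrite -[g]hclassK -[h]hclassK !hmapE.
rewrite -[c *: _]/(hscale c _) -[c *: hclass _]/(hscale c _) !hclassZ -!hclassD hmapE.
by congr hclass; apply: val_inj; rewrite /= linearP.
Qed.

HB.instance Definition _ :=
  GRing.isLinear.Build R (homology X n) (homology Y n) *:%R hmap hmap_is_linear.

End Functor.
Arguments hmap {X Y} f n h.

Lemma hmap_id X n (h : homology X n) : hmap (chain_id X) n h = h.
Proof. rewrite -[h]hclassK hmapE; congr hclass; exact: val_inj. Qed.
Lemma hmap_comp X Y Z (g : chain_map Y Z) (f : chain_map X Y) n h :
  hmap (chain_comp g f) n h = hmap g n (hmap f n h).
Proof. rewrite -[h]hclassK !hmapE; congr hclass; exact: val_inj. Qed.

Definition quasi_iso X Y (f : chain_map X Y) : Prop :=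
  forall n, bijective (hmap f n).

End Homology.
Arguments hmap {R X Y} f n h.

(* The derived category is the localization of the category of complexes at the
   quasi-isomorphisms, presented by generators and relations: [dmor X Y] are the
   formal composites of chain maps and of formal inverses of quasi-isomorphisms,
   and [deq] is equality of morphisms in the localization. *)
Section Derived.
Context {R : pzRingType}.

Inductive dmor : complex R -> complex R -> Type :=
| dmap X Y (f : chain_map X Y) : dmor X Y
| dinv X Y (s : chain_map X Y) (qs : quasi_iso s) : dmor Y X
| dcomp X Y Z (q : dmor Y Z) (p : dmor X Y) : dmor X Z.

Inductive deq : forall X Y, dmor X Y -> dmor X Y -> Prop :=
| deq_refl X Y (p : dmor X Y) : deq p p
| deq_sym X Y (p q : dmor X Y) : deq p q -> deq q p
| deq_trans X Y (p q r : dmor X Y) : deq p q -> deq q r -> deq p r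
| deq_compose X Y Z (q q' : dmor Y Z) (p p' : dmor X Y) :
    deq q q' -> deq p p' -> deq (dcomp q p) (dcomp q' p')
| deq_assoc W X Y Z (r : dmor Y Z) (q : dmor X Y) (p : dmor W X) :
    deq (dcomp r (dcomp q p)) (dcomp (dcomp r q) p)
| deq_idl X Y (p : dmor X Y) : deq (dcomp (dmap (chain_id Y)) p) p
| deq_idr X Y (p : dmor X Y) : deq (dcomp p (dmap (chain_id X))) p
| deq_ext X Y (f g : chain_map X Y) :
    (forall n x, f n x = g n x) -> deq (dmap f) (dmap g)
| deq_map X Y Z (g : chain_map Y Z) (f : chain_map X Y) :
    deq (dmap (chain_comp g f)) (dcomp (dmap g) (dmap f))
| deq_invl X Y (s : chain_map X Y) (qs : quasi_iso s) :
    deq (dcomp (dinv qs) (dmap s)) (dmap (chain_id X))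
| deq_invr X Y (s : chain_map X Y) (qs : quasi_iso s) :
    deq (dcomp (dmap s) (dinv qs)) (dmap (chain_id Y)).

Definition diso (X Y : complex R) : Prop :=
  exists (p : dmor X Y) (q : dmor Y X),
    deq (dcomp q p) (dmap (chain_id X)) /\ deq (dcomp p q) (dmap (chain_id Y)).

(* The functor H_n on the derived category. On [dinv qs] it is the inverse
   function of the bijection H_n(s); the default value 0 is never used. *)
Fixpoint dhmap X Y (p : dmor X Y) (n : int) : homology X n -> homology Y n :=
  match p in dmor X Y return homology X n -> homology Y n with
  | dmap _ _ f => hmap f n
  | dinv _ _ s _ => fun h => xget 0 [set g | hmap s n g = h]
  | dcomp _ _ _ q p => fun h => dhmap q (dhmap p h)
  end.
Arguments dhmap {X Y} p n h.

Lemma dhmap_deq X Y (p q : dmor X Y) : deq p q ->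
  forall n h, dhmap p n h = dhmap q n h.
Proof.
elim=> //=.
- by move=> ? ? ? ? ? _ H1 _ H2 n h; rewrite H1 H2.
- by move=> ? ? ? ? ? ? ? _ H1 _ H2 n h; rewrite H1 H2.
- by move=> *; rewrite hmap_id.
- by move=> *; rewrite hmap_id.
- move=> ? ? f g H n h; rewrite -[h]hclassK !hmapE; congr hclass; apply: val_inj; exact: H.
- by move=> *; rewrite hmap_comp.
- move=> X0 Y0 s qs n h; rewrite hmap_id; case: xgetP => [y -> /= /(bij_inj (qs n))//|/(_ h)]; by case.
- move=> X0 Y0 s qs n h; rewrite hmap_id; case: (qs n) => g _ gK; case: xgetP => [y -> //|/(_ (g h))]; case; exact: gK.
Qed.

Definition map_connected (k : int) X Y (p : dmor X Y) : Prop :=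
  (forall j : int, (j < k)%R -> bijective (dhmap p j)) /\
  (forall h : homology Y k, exists g : homology X k, dhmap p k g = h).

Definition connected (k : int) (A : complex R) : Prop :=
  map_connected k (dmap (chain_zero zero_complex A)).

Definition skeletal (k : int) (A : complex R) : Prop :=
  forall X Y (p : dmor X Y), map_connected k p ->
  forall f : dmor A Y, exists g : dmor A X, deq (dcomp p g) f.

Definition projective_amplitude (a b : int) (A : complex R) : Prop :=
  exists P : complex R,
    [/\ forall n, projective (P n),
        forall n : int, (n < a)%R \/ (b < n)%R -> forall x : P n, x = 0 &
        diso A P].

End Derived.
Arguments dhmap {R X Y} p n h.

(* Main.v *)
(* The fiber of a chain map [p : X -> Y] is exact in the degrees where [p] is
   injective on [H_n] and surjective on [H_(n + 1)], and maps out of a bounded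
   below complex of projectives lift, up to homotopy, along any [p] whose fiber
   is exact wherever needed. So such complexes have homotopy classes of chain
   maps as derived morphisms, and they are [b]-skeletal when they vanish above
   [b]. Conversely, resolve [A] by projectives [Q] vanishing below [a]. The
   inclusion into [Q] of its brutal truncation at [b] is [b]-connected, so
   skeletality makes the identity of [Q] homotopic to a map vanishing above [b];
   the homotopy splits the boundaries off [Q b], and the complement of the
   boundaries together with the lower part of [Q] is the desired complex. *)
Require Import Defs.
From Corelib Require Import Setoid Morphisms.
From HB Require Import structures.
From mathcomp Require Import all_boot all_order all_algebra.
From mathcomp Require Import zify.
From mathcomp Require Import boolp classical_sets functions fsbigop.

Set Implicit Arguments.
Unset Strict Implicit.
Unset Printing Implicit Defensive.

Import Order.TTheory GRing.Theory Num.Theory.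
Local Open Scope ring_scope.

(** * Kernels of linear maps and retracts of projective modules *)

Section Modules.
Context {R : pzRingType}.
Implicit Types U V W : lmodType R.

Definition lin_of U V (f : U -> V) (lf : linear f) : {linear U -> V} :=
  HB.pack f (GRing.isLinear.Build R U V *:%R f lf).

Section Kernel.
Variables (U V : lmodType R) (f : {linear U -> V}).

Definition in_ker : {pred U} := fun x => f x == 0.

Fact in_ker_submod : subsemimod_closed in_ker.
Proof.
split=> [|c x]; first split=> [|x y]; rewrite !unfold_in /in_ker ?linear0 //.
  by rewrite linearD => /eqP-> /eqP->; rewrite addr0.
by rewrite linearZ /= => /eqP->; rewrite scaler0.
Qed.

Record ker : predArgType := Ker { ker_val : U; _ : in_ker ker_val }.
HB.instance Definition _ := [isSub for ker_val].
HB.instance Definition _ := [Choice of ker by <:].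
HB.instance Definition _ :=
  GRing.SubChoice_isSubLmodule.Build R U in_ker ker in_ker_submod.

Lemma ker_valP (x : ker) : f (ker_val x) = 0.
Proof. exact/eqP/(valP x). Qed.

Definition mk_ker x (fx : f x = 0) : ker := Ker (introT eqP fx).

Fact ker_val_linear : linear ker_val. Proof. by []. Qed.
Definition ker_incl : {linear ker -> U} := lin_of ker_val_linear.

End Kernel.

Section KernelLift.
Variables (U V W : lmodType R) (f : {linear U -> V}) (g : {linear W -> U}).
Hypothesis fg0 : forall x, f (g x) = 0.

Definition ker_lift_fun x : ker f := mk_ker (fg0 x).
Fact ker_lift_linear : linear ker_lift_fun.
Proof. by move=> c x y; apply: val_inj; rewrite /= linearP. Qed.
Definition ker_lift : {linear W -> ker f} := lin_of ker_lift_linear.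

End KernelLift.

Lemma projective_retract U V (i : {linear V -> U}) (r : {linear U -> V}) :
  (forall x, r (i x) = x) -> projective U -> projective V.
Proof.
move=> ri pU M N e f e_surj.
have [g eg] := pU M N e (f \o r) e_surj.
by exists (g \o i) => x /=; rewrite eg /= ri.
Qed.

End Modules.

Section PairLin.
Context {R : pzRingType} (U V W : lmodType R).
Variables (f : {linear U -> V}) (g : {linear U -> W}).
Definition pair_fun x : V * W := (f x, g x).
Fact pair_fun_linear : linear pair_fun.
Proof. by move=> c x y; rewrite /pair_fun !linearP. Qed.
Definition pair_lin : {linear U -> prod V W} := lin_of pair_fun_linear.
End PairLin.
Arguments pair_fun {R U V W} f g x /.

(** * Free modules and enough projectives *)

Section FreeModule.
Context {R : pzRingType} (T : choiceType).

Definition fin_supp : {pred T -> R^o} :=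
  fun c => `[< exists r : seq T, forall x, x \notin r -> c x = 0 >].

Fact fin_supp_submod : subsemimod_closed fin_supp.
Proof.
split=> [|a c]; first split=> [|c c']; rewrite !unfold_in.
- by apply/asboolP; exists [::].
- move=> /asboolP[r cr] /asboolP[r' cr']; apply/asboolP; exists (r ++ r') => x.
  rewrite mem_cat negb_or => /andP[/cr cx /cr' c'x].
  by rewrite -[LHS]/(c x + c' x) cx c'x addr0.
- move=> /asboolP[r cr]; apply/asboolP; exists r => x /cr cx.
  by rewrite -[LHS]/(a *: c x) cx scaler0.
Qed.

Record free_mod : predArgType := FreeMod { coef : T -> R^o; _ : fin_supp coef }.
HB.instance Definition _ := [isSub for coef].
HB.instance Definition _ := [Choice of free_mod by <:].
HB.instance Definition _ :=
  GRing.SubChoice_isSubLmodule.Build R (T -> R^o) fin_supp free_mod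
    fin_supp_submod.

Lemma coefP (c : free_mod) :
  exists2 r : seq T, uniq r & forall x, x \notin r -> coef c x = 0.
Proof.
case: c => c /= /asboolP[r cr]; exists (undup r); first exact: undup_uniq.
by move=> x; rewrite mem_undup; apply: cr.
Qed.

Fact delta_supp t : fin_supp (fun x : T => (x == t)%:R : R^o).
Proof. by apply/asboolP; exists [:: t] => x; rewrite inE => /negPf->. Qed.
Definition delta t : free_mod := FreeMod (delta_supp t).

Section Extend.
Variables (M : lmodType R) (m : T -> M).

(** This form of the sum depends on no list enumerating the support; [extendE] evaluates it on any
    list covering it. *)
Definition extend_fun (c : free_mod) : M :=
  \sum_(x \in [set: T]) (coef c x : R) *: m x.

Lemma extendE (c : free_mod) r :
    uniq r -> (forall x, x \notin r -> coef c x = 0) ->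
  extend_fun c = \sum_(x <- r) (coef c x : R) *: m x.
Proof.
move=> ur cr; rewrite /extend_fun (fsbigE r) //=; last first.
  by move=> x _ /cr ->; rewrite scale0r.
by apply: eq_bigl => x; rewrite in_setT.
Qed.

Fact extend_linear : linear extend_fun.
Proof.
move=> a c c'; have [r _ cr] := coefP c; have [r' _ cr'] := coefP c'.
have us := undup_uniq (r ++ r').
have cs x : x \notin undup (r ++ r') -> coef c x = 0 /\ coef c' x = 0.
  by rewrite mem_undup mem_cat negb_or => /andP[/cr -> /cr' ->].
rewrite !(extendE us) => [|x /cs[]//|x /cs[]//|x /cs[cx c'x]]; last first.
  by rewrite -[LHS]/(a *: coef c x + coef c' x) cx c'x scaler0 addr0.
rewrite scaler_sumr -big_split; apply: eq_bigr => x _.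
by rewrite /= scalerA -scalerDl.
Qed.
Definition extend : {linear free_mod -> M} := lin_of extend_linear.

Lemma extend_delta t : extend (delta t) = m t.
Proof.
rewrite /= (@extendE _ [:: t]) //= => [|x]; last by rewrite inE => /negPf->.
by rewrite big_seq1 /= eqxx scale1r.
Qed.

End Extend.

Lemma free_sum_delta (c : free_mod) r : uniq r ->
    (forall x, x \notin r -> coef c x = 0) ->
  c = \sum_(x <- r) (coef c x : R) *: delta x.
Proof.
move=> ur cr; apply: val_inj; rewrite [RHS]raddf_sum; apply/funext => t.
rewrite fct_sumE /=; have [tr|tr] := boolP (t \in r); last first.
  rewrite cr // big_seq big1 // => x xr.
  by rewrite -[LHS]/(coef c x * (t == x)%:R) (negPf (memPnC tr x xr)) mulr0.
rewrite (bigD1_seq t) //= big1 => [|x xt].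
  by rewrite addr0 -[RHS]/(coef c t * (t == t)%:R) eqxx mulr1.
by rewrite -[LHS]/(coef c x * (t == x)%:R) eq_sym (negPf xt) mulr0.
Qed.

(** Preimages are chosen for the values on the basis [delta t], and [extend] makes a linear map of
    them. *)
Lemma projective_free : projective free_mod.
Proof.
move=> M N e f /= e_surj.
have [m em] := choice (fun t => e_surj (f (delta t))).
exists (extend m) => c; have [r ur cr] := coefP c.
rewrite /= (extendE _ ur cr) [in RHS](free_sum_delta ur cr) !linear_sum.
by apply: eq_bigr => x _; rewrite !linearZ /= em.
Qed.

End FreeModule.

Lemma enough_projectives (R : pzRingType) (N : lmodType R) :
  exists (P : lmodType R) (e : {linear P -> N}),
    projective P /\ forall y, exists x, e x = y.
Proof.
exists (free_mod N), (extend id); split; first exact: projective_free.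
by move=> y; exists (delta y); rewrite extend_delta.
Qed.

(** * Complexes from one differential per degree, and criteria for maps on homology *)

Lemma int_succP (n : int) : exists m, n = m + 1.
Proof. by exists (n - 1); rewrite subrK. Qed.

Section Complexes.
Context {R : pzRingType}.
Implicit Types X Y Z : complex R.

Section MkComplex.
Variables (M : int -> lmodType R) (d : forall n, {linear M (n + 1) -> M n}).
Hypothesis dd : forall n x, d n (d (n + 1) x) = 0.

(** Transport along [i = j + 1] is confined to this definition; [mk_dE] removes it by uniqueness of
    equality proofs in [int]. *)
Definition mk_d i j : {linear M i -> M j} :=
  if i =P j + 1 is ReflectT e
  then ecast k {linear M k -> M j} (esym e) (d j) else \0.

Lemma mk_dE n x : mk_d (n + 1) n x = d n x.
Proof. by rewrite /mk_d; case: eqP => // e; rewrite eq_axiomK. Qed.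

Fact mk_d_shape i j : i <> j + 1 -> forall x, mk_d i j x = 0.
Proof. by rewrite /mk_d; case: eqP. Qed.

Fact mk_dd i j k x : mk_d j k (mk_d i j x) = 0.
Proof.
have [ij|ij] := pselect (i = j + 1); last by rewrite (mk_d_shape ij) linear0.
have [jk|jk] := pselect (j = k + 1); last exact: mk_d_shape.
by subst i j; rewrite !mk_dE dd.
Qed.

Definition mk_complex : complex R := Complex mk_d_shape mk_dd.

Lemma mk_complexE n x : cpx_d mk_complex (n + 1) n x = d n x.
Proof. exact: mk_dE. Qed.
End MkComplex.

Section MkChainMap.
Variables (X Y : complex R) (f : forall n, {linear X n -> Y n}).
Hypothesis fd : forall n x,
  f n (cpx_d X (n + 1) n x) = cpx_d Y (n + 1) n (f (n + 1) x).

Fact mk_chain_map_comm i j x : f j (cpx_d X i j x) = cpx_d Y i j (f i x).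
Proof.
have [ij|ij] := pselect (i = j + 1); first by subst i.
by rewrite !(cpx_shape ij) linear0.
Qed.
Definition mk_chain_map : chain_map X Y := ChainMap mk_chain_map_comm.
End MkChainMap.

(** Quantifying over all targets keeps the index [n - 1] out of the cycle condition; only the target
    with [n = j + 1] carries information. *)
Definition cyc X n (w : X n) : Prop := forall j, cpx_d X n j w = 0.

Lemma cycS X n (x : X (n + 1)) : cpx_d X (n + 1) n x = 0 -> cyc x.
Proof.
move=> dx j; have [nj|/cpx_shape->//] := pselect (n + 1 = j + 1).
by have e : n = j; [exact: (addIr 1 nj) | subst j].
Qed.

Lemma cycP X n (w : X n) : is_cycle w <-> cyc w.
Proof.
split=> [/eqP dw|dw]; last exact/eqP/dw.
by have [m e] := int_succP n; subst n; apply: cycS; rewrite addrK in dw.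
Qed.

Lemma cyc_d X m n (x : X m) : cyc (cpx_d X m n x).
Proof. by move=> j; rewrite cpx_dd. Qed.

Lemma hclass_eqP X n (z w : cycles X n) :
  hclass z = hclass w <->
  exists x, cpx_d X (n + 1) n x = cycle_val z - cycle_val w.
Proof. by rewrite hclass_eq; split=> [/asboolP|?]; last apply/asboolP. Qed.

Lemma hclassP X n (h : homology X n) :
  exists z : X n, exists cz : is_cycle z, h = hclass (Cycle cz).
Proof.
by rewrite -[h]hclassK; case: (repr h) => z cz; exists z, cz.
Qed.

(* Exactness of the fiber of [f], whose degree [n] part is [X n * Y (n + 1)]. *)
Definition lifts X Y (f : chain_map X Y) n : Prop :=
  forall (w : X n) (y : Y (n + 1)), cyc w -> f n w = cpx_d Y (n + 1) n y ->
  exists (x : X (n + 1)) (u : Y (n + 1 + 1)),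
    cpx_d X (n + 1) n x = w /\ y = f (n + 1) x + cpx_d Y (n + 1 + 1) (n + 1) u.

Lemma hmap_injP X Y (f : chain_map X Y) n :
  injective (hmap f n) <->
  forall w, cyc w -> forall y, f n w = cpx_d Y (n + 1) n y ->
    exists x, cpx_d X (n + 1) n x = w.
Proof.
split=> [f_inj w /cycP cw y fw|f_inj g h].
  have [|x] := (hclass_eqP (Cycle cw) 0).1; last first.
    by rewrite /= subr0 => dx; exists x.
  apply: f_inj; rewrite !hmapE; apply/hclass_eqP; exists y.
  by rewrite /= linear0 subr0.
have [z [cz ->]] := hclassP g; have [w [cw ->]] := hclassP h.
rewrite !hmapE => /hclass_eqP[y /= dy]; apply/hclass_eqP.
apply: (f_inj _ _ y); last by rewrite linearB.
by move=> j; rewrite linearB /= ((cycP z).1 cz) ((cycP w).1 cw) subr0.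
Qed.

Lemma hmap_surjP X Y (f : chain_map X Y) n :
  (forall h, exists g, hmap f n g = h) <->
  forall y, cyc y -> exists x u, cyc x /\ y = f n x + cpx_d Y (n + 1) n u.
Proof.
split=> [f_surj y /cycP cy|f_surj h].
  have [g] := f_surj (hclass (Cycle cy)); have [x [cx ->]] := hclassP g.
  rewrite hmapE => /esym/hclass_eqP[u /= du]; exists x, u.
  by split; [apply/cycP | rewrite du [RHS]addrC subrK].
have [y [cy ->]] := hclassP h.
have [x [u [/cycP cx yE]]] := f_surj y ((cycP y).1 cy).
exists (hclass (Cycle cx)); rewrite hmapE; apply/esym/hclass_eqP; exists u.
by rewrite /= yE [_ + cpx_d _ _ _ _]addrC addrK.
Qed.

Lemma inj_surj_bij (T T' : Type) (f : T -> T') :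
  injective f -> (forall y, exists x, f x = y) -> bijective f.
Proof.
move=> f_inj /choice[g fg]; exists g => // x.
by apply: f_inj; rewrite fg.
Qed.

Lemma bij_surj (T T' : Type) (f : T -> T') :
  bijective f -> forall y, exists x, f x = y.
Proof. by move=> [g _ gK] y; exists (g y). Qed.

Lemma liftsP X Y (f : chain_map X Y) n :
  lifts f n <->
  injective (hmap f n) /\ (forall h, exists g, hmap f (n + 1) g = h).
Proof.
rewrite hmap_injP hmap_surjP; split=> [lf|[f_inj f_surj] w y cw fw].
  split=> [w cw y fw|y cy]; first by have [x [u []]] := lf w y cw fw; exists x.
  have [||x [u [dx yE]]] := lf 0 y; first by move=> j; rewrite linear0.
    by rewrite linear0 cy.
  by exists x, u; split=> //; exact: cycS.
(* Injectivity gives a preimage [x0] of [w]; its image misses [y] by a cycle, which surjectivity one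
   degree up corrects. *)
have [x0 dx0] := f_inj w cw y fw.
have [|x1 [u [cx1 yE]]] := f_surj (y - f (n + 1) x0).
  by apply: cycS; rewrite linearB /= -cm_comm dx0 fw subrr.
exists (x0 + x1), u; split; first by rewrite linearD /= dx0 cx1 addr0.
by rewrite linearD /= -addrA -yE [RHS]addrC subrK.
Qed.

Lemma quasi_isoP X Y (f : chain_map X Y) :
  quasi_iso f <-> forall n, lifts f n.
Proof.
split=> [qf n|lf n].
  by apply/liftsP; split; [exact: bij_inj | exact: bij_surj].
apply: inj_surj_bij; first by have /liftsP[] := lf n.
by have [m ->] := int_succP n; have /liftsP[] := lf m.
Qed.

(** In [liftsP], surjectivity is read one degree above injectivity, so the degrees [n < k] give
    injectivity below [k] and surjectivity up to [k] included. *)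
Lemma map_connectedP (k : int) X Y (f : chain_map X Y) :
  map_connected k (dmap f) <-> forall n : int, n < k -> lifts f n.
Proof.
split=> [[f_bij f_surj] n nk|lf].
  apply/liftsP; split; first exact/bij_inj/f_bij.
  have [nk1|] := ltP (n + 1) k; first exact/bij_surj/f_bij.
  rewrite -lezD1 in nk; move=> kn1; have e : n + 1 = k by apply/le_anti/andP.
  by subst k.
have fS j : (j <= k) -> forall h, exists g, hmap f j g = h.
  have [m ->] := int_succP j => /=; rewrite lezD1 => mk.
  by have /liftsP[] := lf m mk.
split=> [j jk /=|]; last exact: fS.
by apply: inj_surj_bij; [have /liftsP[] := lf j jk | exact/fS/ltW].
Qed.

Lemma bij_comp_inv (T T' T'' : Type) (f : T -> T') (g : T' -> T'') h :
  (forall x, g (f x) = h x) -> bijective g -> bijective h -> bijective f.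
Proof.
move=> gf g_bij h_bij; have [g' gK g'K] := g_bij.
apply: (@eq_bij _ _ (g' \o h)); last by move=> x /=; rewrite -gf gK.
by apply: bij_comp => //; exists g.
Qed.

Lemma quasi_iso_id X : quasi_iso (chain_id X).
Proof. by move=> n; exists id => h; rewrite hmap_id. Qed.

Lemma quasi_iso_comp X Y Z (g : chain_map Y Z) (f : chain_map X Y) :
  quasi_iso g -> quasi_iso f -> quasi_iso (chain_comp g f).
Proof.
move=> qg qf n; apply: (@eq_bij _ _ (hmap g n \o hmap f n)).
  exact: bij_comp.
by move=> h; rewrite /= -hmap_comp.
Qed.

Lemma quasi_iso_cancel X Y Z (g : chain_map Y Z) (f : chain_map X Y)
    (h : chain_map X Z) :
  (forall n x, g n (f n x) = h n x) ->
  quasi_iso g -> quasi_iso h -> quasi_iso f.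
Proof.
move=> gf qg qh n; apply: (bij_comp_inv _ (qg n) (qh n)) => x.
rewrite -hmap_comp.
exact: (dhmap_deq (@deq_ext R _ _ (chain_comp g f) h gf) x).
Qed.

Lemma connectedP k X :
  connected k X <-> forall n : int, n <= k -> forall x : X n, cyc x ->
    exists y, x = cpx_d X (n + 1) n y.
Proof.
rewrite /connected map_connectedP; split=> [lX n|eX n nk w y _ /=].
  have [m ->] := int_succP n; rewrite lezD1 => mk y cy.
  have [||x [u [_ yE]]] := lX m mk 0 y; first by [].
    by rewrite linear0 cy.
  by exists u; rewrite yE /= add0r.
move=> /esym dy.
have [|u yE] := eX (n + 1) _ y (cycS dy); first by rewrite lezD1.
exists 0, u; split; last by rewrite /= add0r.
by apply/matrixP => i [].
Qed.

End Complexes.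

(** * Chain homotopies *)

Section Homotopy.
Context {R : pzRingType}.
Implicit Types X Y Z : complex R.

(** Writing the relation in degree [n + 1] reaches every integer degree and keeps [n - 1] out of the
    types. *)
Definition homotopic X Y (f g : chain_map X Y) : Prop :=
  exists h : forall n, {linear X n -> Y (n + 1)}, forall n x,
    f (n + 1) x - g (n + 1) x =
    cpx_d Y (n + 1 + 1) (n + 1) (h (n + 1) x) + h n (cpx_d X (n + 1) n x).

Lemma homotopic_ext X Y (f g : chain_map X Y) :
  (forall n x, f n x = g n x) -> homotopic f g.
Proof.
by move=> fg; exists (fun n => \0) => n x; rewrite fg subrr /= linear0 addr0.
Qed.

Lemma homotopic_refl X Y (f : chain_map X Y) : homotopic f f.
Proof. exact: homotopic_ext. Qed.

Lemma homotopic_sym X Y (f g : chain_map X Y) : homotopic f g -> homotopic g f.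
Proof.
move=> [h fg]; exists (fun n => \- h n) => n x.
by rewrite /= linearN /= -opprD -fg opprB.
Qed.

Lemma homotopic_trans X Y (f g k : chain_map X Y) :
  homotopic f g -> homotopic g k -> homotopic f k.
Proof.
move=> [h fg] [h' gk]; exists (fun n => h n \+ h' n) => n x.
by rewrite /= linearD /= addrACA -fg -gk addrA subrK.
Qed.

Lemma homotopic_compl X Y Z (k : chain_map Y Z) (f g : chain_map X Y) :
  homotopic f g -> homotopic (chain_comp k f) (chain_comp k g).
Proof.
move=> [h fg]; exists (fun n => k (n + 1) \o h n) => n x.
by rewrite /= -cm_comm -linearB fg linearD.
Qed.

Lemma homotopic_compr X Y Z (f g : chain_map Y Z) (k : chain_map X Y) :
  homotopic f g -> homotopic (chain_comp f k) (chain_comp g k).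
Proof.
move=> [h fg]; exists (fun n => h n \o k n) => n x.
by rewrite /= cm_comm -fg.
Qed.

End Homotopy.

(** * Homotopy pullbacks of complexes *)

Section HomotopyPullback.
Context {R : pzRingType}.
Variables (X X' Y : complex R) (f : chain_map X Y) (s : chain_map X' Y).

(** With [hpb_d] this is the shifted mapping cone of [(f, -s)] from the sum of [X] and [X'] to [Y];
    the middle coordinate is a homotopy between the images of the outer two. *)
Definition hpb_mod (n : int) : lmodType R :=
  prod (prod (X n) (Y (n + 1))) (X' n).

Definition hpb_mid n : {linear hpb_mod (n + 1) -> Y (n + 1)} :=
  ((f (n + 1) \o fst \o fst) \- (s (n + 1) \o snd))
  \- (cpx_d Y (n + 1 + 1) (n + 1) \o snd \o fst).

Definition hpb_d n : {linear hpb_mod (n + 1) -> hpb_mod n} :=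
  pair_lin (pair_lin (cpx_d X (n + 1) n \o fst \o fst) (hpb_mid n))
           (cpx_d X' (n + 1) n \o snd).

Fact hpb_dd n (p : hpb_mod (n + 1 + 1)) :
  hpb_d n (hpb_d (n + 1) p) = 0.
Proof.
rewrite /= !cpx_dd !linearB /= !cm_comm cpx_dd.
by rewrite !opprK addr0 addrACA subrr addNr addr0.
Qed.

Definition hpb : complex R := mk_complex hpb_dd.

Lemma hpb_dE n (p : hpb (n + 1)) : cpx_d hpb (n + 1) n p = hpb_d n p.
Proof. exact: mk_complexE. Qed.

Fact hpb_fst_comm n (p : hpb (n + 1)) :
  (fst \o fst : {linear hpb_mod n -> X n}) (cpx_d hpb (n + 1) n p) =
  cpx_d X (n + 1) n ((fst \o fst : {linear hpb_mod (n + 1) -> X (n + 1)}) p).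
Proof. by rewrite hpb_dE. Qed.
Definition hpb_fst : chain_map hpb X :=
  @mk_chain_map _ hpb X (fun n => fst \o fst) hpb_fst_comm.

Fact hpb_snd_comm n (p : hpb (n + 1)) :
  (snd : {linear hpb_mod n -> X' n}) (cpx_d hpb (n + 1) n p) =
  cpx_d X' (n + 1) n ((snd : {linear hpb_mod (n + 1) -> X' (n + 1)}) p).
Proof. by rewrite hpb_dE. Qed.
Definition hpb_snd : chain_map hpb X' :=
  @mk_chain_map _ hpb X' (fun n => snd) hpb_snd_comm.

Lemma hpb_homotopic : homotopic (chain_comp f hpb_fst) (chain_comp s hpb_snd).
Proof.
exists (fun n => (snd \o fst : {linear hpb_mod n -> Y (n + 1)})) => n p.
by rewrite hpb_dE /= [RHS]addrC subrK.
Qed.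

(** The kernel of [hpb_fst] is the fiber of [s] up to sign. The first coordinate of the preimage is
    [y], and exactness of the fiber of [s] supplies the other two. *)
Lemma hpb_fst_qi : quasi_iso s -> quasi_iso hpb_fst.
Proof.
move=> /quasi_isoP ls; apply/quasi_isoP => n.
have [m e] := int_succP n; subst n.
move=> [[x u] x'] y cw /= xy.
have := cw m; rewrite hpb_dE => -[] dx /eqP; rewrite subr_eq0 => /eqP du dx'.
have [||x1 [u1 [dx1 yE]]] := ls (m + 1) x' (f (m + 1 + 1) y - u).
- exact: cycS.
- by rewrite linearB /= -cm_comm -xy -du /= subKr.
exists ((y, u1, x1) : hpb_mod (m + 1 + 1)), 0; split; last first.
  by rewrite linear0 addr0.
rewrite hpb_dE /= dx1 -xy; congr (_, _, _).
by rewrite -[LHS]addrA -opprD -yE subKr.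
Qed.

Section Lift.
Variables (W : complex R) (a : chain_map W X) (c : chain_map W X').
Variable h : forall n, {linear W n -> Y (n + 1)}.
Hypothesis hE : forall n x, f (n + 1) (a (n + 1) x) - s (n + 1) (c (n + 1) x) =
  cpx_d Y (n + 1 + 1) (n + 1) (h (n + 1) x) + h n (cpx_d W (n + 1) n x).

Definition hpb_lift_fun n : {linear W n -> hpb_mod n} :=
  pair_lin (pair_lin (a n) (h n)) (c n).
Fact hpb_lift_comm n (x : W (n + 1)) :
  hpb_lift_fun n (cpx_d W (n + 1) n x) =
  cpx_d hpb (n + 1) n (hpb_lift_fun (n + 1) x).
Proof.
rewrite hpb_dE /= !cm_comm; congr (_, _, _).
by rewrite hE [X in _ = X - _]addrC addrK.
Qed.
Definition hpb_lift : chain_map W hpb :=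
  @mk_chain_map _ W hpb hpb_lift_fun hpb_lift_comm.
End Lift.

Lemma hpb_lift_exists W (a : chain_map W X) (c : chain_map W X') :
  homotopic (chain_comp f a) (chain_comp s c) ->
  exists k : chain_map W hpb,
    (forall n x, hpb_fst n (k n x) = a n x) /\
    (forall n x, hpb_snd n (k n x) = c n x).
Proof. by move=> [h hE]; exists (hpb_lift hE). Qed.

End HomotopyPullback.

(** * Calculus of right fractions in the derived category *)

#[local] Instance deq_equivalence (R : pzRingType) (X Y : complex R) :
  Equivalence (@deq R X Y).
Proof. split; [exact: deq_refl | exact: deq_sym | exact: deq_trans]. Qed.

#[local] Instance dcomp_proper (R : pzRingType) (X Y Z : complex R) :
  Proper (respectful (@deq R Y Z)
    (respectful (@deq R X Y) (@deq R X Z))) (@dcomp R X Y Z).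
Proof. by move=> q q' qq p p' pp; exact: deq_compose. Qed.

#[local] Hint Resolve deq_refl : core.

Section Fractions.
Context {R : pzRingType}.
Implicit Types X Y Z : complex R.

(** The homotopy pullback of two identities is a path object; [k], a section of both ends, plays the
    role of the constant paths. *)
Lemma path_const X : exists k : chain_map X (hpb (chain_id X) (chain_id X)),
  [/\ quasi_iso k, forall n x, hpb_fst _ _ n (k n x) = chain_id X n x &
      forall n x, hpb_snd _ _ n (k n x) = chain_id X n x].
Proof.
have [k [k1 k2]] := hpb_lift_exists
  (homotopic_refl (chain_comp (chain_id X) (chain_id X))).
exists k; split=> //.
have q1 := @quasi_iso_id _ X.
exact: (quasi_iso_cancel k1 (hpb_fst_qi _ q1) q1).
Qed.

Lemma deq_dmap_comp X Y Z (g : chain_map Y Z) (f : chain_map X Y)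
    (h : chain_map X Z) :
  (forall n x, g n (f n x) = h n x) -> deq (dcomp (dmap g) (dmap f)) (dmap h).
Proof. by move=> gf; rewrite -deq_map; exact: deq_ext. Qed.

Lemma dinvK X Y Z (s : chain_map X Y) (qs : quasi_iso s) (p : dmor X Z) :
  deq (dcomp (dcomp p (dinv qs)) (dmap s)) p.
Proof. by rewrite -deq_assoc deq_invl deq_idr. Qed.

Lemma deq_epi X Y Z (s : chain_map X Y) (qs : quasi_iso s) (p q : dmor Y Z) :
  deq (dcomp p (dmap s)) (dcomp q (dmap s)) -> deq p q.
Proof.
by move=> pq; rewrite -(deq_idr p) -(deq_idr q) -(deq_invr qs) !deq_assoc pq.
Qed.

(** A homotopy is a map into the path object of [Y], and the two ends of that object agree in the
    derived category, being inverse to the same [k]. *)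
Lemma homotopic_deq X Y (f g : chain_map X Y) :
  homotopic f g -> deq (dmap f) (dmap g).
Proof.
move=> fg; have [k [qk k1 k2]] := path_const Y.
have [l [l1 l2]] := @hpb_lift_exists _ _ _ _ (chain_id Y) (chain_id Y) _ f g fg.
have e : deq (dmap (hpb_fst (chain_id Y) (chain_id Y))) (dmap (hpb_snd _ _)).
  by apply: (deq_epi qk); rewrite (deq_dmap_comp k1) (deq_dmap_comp k2).
by rewrite -(deq_dmap_comp l1) -(deq_dmap_comp l2) e.
Qed.

(** An Ore condition: a homotopy commutative square moves a formal inverse from one side of a map to
    the other. *)
Lemma dinv_swap X Y Y' Z (t : chain_map X Y) (s : chain_map Y' Y)
    (qs : quasi_iso s) (u : chain_map Z X) (qu : quasi_iso u)
    (v : chain_map Z Y') :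
  homotopic (chain_comp t u) (chain_comp s v) ->
  deq (dcomp (dinv qs) (dmap t)) (dcomp (dmap v) (dinv qu)).
Proof.
move=> /homotopic_deq; rewrite !deq_map => tu; apply: (deq_epi qu).
by rewrite dinvK -deq_assoc tu deq_assoc deq_invl deq_idl.
Qed.

(** For a composite of two fractions, the homotopy pullback of the inner legs [t'] and [s] supplies
    a common denominator. *)
Lemma right_fraction X Y (q : dmor X Y) :
  exists Z (s : chain_map Z X) (qs : quasi_iso s) (t : chain_map Z Y),
    deq q (dcomp (dmap t) (dinv qs)).
Proof.
elim: q => {X Y} [X Y f|X Y s qs
  |X Y Z q [V [s [qs [t qE]]]] p [W [s' [qs' [t' pE]]]]].
- exists X, (chain_id X), (@quasi_iso_id _ X), f.
  by apply: (deq_epi (@quasi_iso_id _ X)); rewrite dinvK deq_idr.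
- by exists X, s, qs, (chain_id X); rewrite deq_idl.
have qu := hpb_fst_qi t' qs; have qsu := quasi_iso_comp qs' qu.
exists _, _, qsu, (chain_comp t (hpb_snd t' s)).
apply: (deq_epi qsu); rewrite dinvK !deq_map qE pE deq_assoc.
rewrite -(deq_assoc _ _ (dmap s')) dinvK -(deq_assoc (dmap t)).
by rewrite (dinv_swap qs qu (hpb_homotopic t' s)) deq_assoc dinvK.
Qed.

End Fractions.

(** * Dependent choice along the integers *)

Lemma int_dep_choice (T : int -> Type) (t0 : forall n, T n)
    (I : forall n, T n -> Prop) (C : forall n, T n -> T (n + 1) -> Prop)
    (a : int) :
  (forall n, n <= a -> I n (t0 n)) ->
  (forall n, n < a -> C n (t0 n) (t0 (n + 1))) ->
  (forall n t, I n t -> exists t', I (n + 1) t' /\ C n t t') ->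
  exists s : forall n, T n,
    (forall n, I n (s n)) /\ forall n, C n (s n) (s (n + 1)).
Proof.
move=> I0 C0 step.
have [F FP] : exists F : forall n, T n -> T (n + 1),
    forall n t, I n t -> I (n + 1) (F n t) /\ C n t (F n t).
  have H n (t : T n) : {t' | I n t -> I (n + 1) t' /\ C n t t'}.
    apply: cid; have [/step[t' t'P]|nI] := pselect (I n t); first by exists t'.
    by exists (t0 (n + 1)).
  by exists (fun n t => sval (H n t)) => n t; exact: (svalP (H n t)).
(* [u m n] starts from [t0] in degree [n - m] and climbs [m] steps with [F]; the cast identifies
   [n - 1 + 1] with [n]. *)
pose u := fix u (m : nat) (n : int) : T n :=
  if m is m'.+1 then ecast k (T k) (subrK 1 n) (F (n - 1) (u m' (n - 1)))
  else t0 n.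
have uS m n : u m.+1 (n + 1) = F n (u m n).
  rewrite /=; move: (n + 1 - 1) (subrK 1 (n + 1)) => k e.
  have ek : k = n by exact: (addIr 1 e).
  by subst k; rewrite eq_axiomK.
(* With this many steps all degrees above [a] are reached from the same start [t0 a], so consecutive
   values are related by [F]. *)
pose depth (n : int) : nat := if n <= a then 0%N else `|n - a|%N.
have dS n : a <= n -> depth (n + 1) = (depth n).+1.
  by rewrite /depth; case: ifP; case: ifP; lia.
have d0 n : n <= a -> depth n = 0%N by rewrite /depth => ->.
have sI n : I n (u (depth n) n).
  have [/[dup]/d0-> /I0//|an] := leP n a.
  have [m nE] : exists m : nat, n = a + m%:Z by exists `|n - a|%N; lia.
  elim: m n nE {an} => [|m IHm] n nE.
    by rewrite d0 /=; [apply: I0; lia | lia].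
  have e : n = (a + m%:Z) + 1 by lia.
  rewrite e dS; last lia.
  by rewrite uS; apply: (FP _ _ _).1; exact: IHm.
exists (fun n => u (depth n) n); split=> // n.
have [na|an] := ltP n a; first by rewrite !d0 /=; [exact: C0 | lia | lia].
by rewrite dS // uS; apply: (FP _ _ _).2.
Qed.

(** * Lifting maps out of complexes of projectives *)

Section Lifting.
Context {R : pzRingType}.
Implicit Types X Y Z Q : complex R.

(** The pair [(g, f)] lands in [ker psi], the cycles of degree [n] in the fiber of [p]. By [lifts],
    [e] maps onto these, so projectivity of [P] lifts the pair. *)
Lemma lift_step X Y (p : chain_map X Y) n (P : lmodType R)
    (g : {linear P -> X n}) (f : {linear P -> Y (n + 1)}) :
  projective P -> lifts p n ->
  (forall z, cyc (g z)) -> (forall z, p n (g z) = cpx_d Y (n + 1) n (f z)) ->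
  exists (g' : {linear P -> X (n + 1)}) (h : {linear P -> Y (n + 1 + 1)}),
    forall z, cpx_d X (n + 1) n (g' z) = g z /\
      f z = p (n + 1) (g' z) + cpx_d Y (n + 1 + 1) (n + 1) (h z).
Proof.
move=> pP lp cg pg.
pose psi : {linear prod (X n) (Y (n + 1)) -> prod (X (n - 1)) (Y n)} :=
  pair_lin (cpx_d X n (n - 1) \o fst)
           ((p n \o fst) \- (cpx_d Y (n + 1) n \o snd)).
pose e : {linear prod (X (n + 1)) (Y (n + 1 + 1)) -> prod (X n) (Y (n + 1))} :=
  pair_lin (cpx_d X (n + 1) n \o fst)
           ((p (n + 1) \o fst) \+ (cpx_d Y (n + 1 + 1) (n + 1) \o snd)).
have psie x : psi (e x) = 0.
  by rewrite /= cpx_dd cm_comm linearD /= cpx_dd addr0 subrr.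
have psifg z : psi (pair_lin g f z) = 0.
  by rewrite /= cg pg subrr.
have e_surj (y : ker psi) : exists x, ker_lift psie x = y.
  have [cw /eqP] : cpx_d X n (n - 1) (val y).1 = 0 /\
      p n (val y).1 - cpx_d Y (n + 1) n (val y).2 = 0.
    by case: (ker_valP y).
  rewrite subr_eq0 => /eqP /lp[|x [u [dx yE]]].
    by apply/cycP/eqP.
  exists (x, u); apply: val_inj; rewrite /= dx -yE.
  exact/esym/surjective_pairing.
have [k kE] := pP _ _ (ker_lift psie) (ker_lift psifg) e_surj.
exists (fst \o k), (snd \o k) => z.
by have /(congr1 val)[-> ->] := kE z.
Qed.

(** The lift and the homotopy are built together, degree by degree upwards, from zero maps below
    [a]. *)
Lemma lift_upto_homotopy Q X Y (p : chain_map X Y) (a : int)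
    (f : chain_map Q Y) :
  (forall n, projective (Q n)) -> (forall n, n < a -> forall x : Q n, x = 0) ->
  (forall n, lifts p n \/ forall x : Q (n + 1), x = 0) ->
  exists g : chain_map Q X, homotopic f (chain_comp p g).
Proof.
move=> pQ Q0 lp.
pose T n : Type := prod {linear Q n -> X n} {linear Q n -> Y (n + 1)}.
pose T0 n : T n :=
  ((\0 : {linear Q n -> X n}), (\0 : {linear Q n -> Y (n + 1)})).
(* Compatibility on cycles is enough of an invariant, since the next step evaluates it on boundaries
   only. *)
pose I n (k : T n) := forall x, cyc x ->
  cyc (k.1 x) /\ p n (k.1 x) = f n x - cpx_d Y (n + 1) n (k.2 x).
pose C n (k : T n) (k' : T (n + 1)) := forall z,
  cpx_d X (n + 1) n (k'.1 z) = k.1 (cpx_d Q (n + 1) n z) /\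
  f (n + 1) z - k.2 (cpx_d Q (n + 1) n z) =
    p (n + 1) (k'.1 z) + cpx_d Y (n + 1 + 1) (n + 1) (k'.2 z).
have [|n na z|n k Ik|s [_ sC]] := @int_dep_choice T T0 I C (a - 1).
- move=> n na x _; rewrite (Q0 n _ x) /=; last by lia.
  by split=> [j|]; rewrite !linear0 ?addr0.
- by rewrite (Q0 _ _ z); [rewrite !linear0 !addr0 | lia].
- have CI k' : C n k k' -> I (n + 1) k'.
    move=> kC x cx; have [dk fE] := kC x; rewrite cx linear0 in dk.
    rewrite cx linear0 subr0 in fE; split; first exact: cycS.
    by rewrite fE addrK.
  suff [k' kC] : exists k', C n k k' by exists k'; split=> //; exact: CI.
  have [lpn|Q00] := lp n; last first.
    by exists (T0 (n + 1)) => z; rewrite (Q00 z) !linear0 !addr0.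
  have [||g' [h gh]] := @lift_step _ _ p n _ (k.1 \o cpx_d Q (n + 1) n)
    (f (n + 1) \- (k.2 \o cpx_d Q (n + 1) n)) (pQ _) lpn.
  - by move=> z; apply: (Ik _ (cyc_d n z)).1.
  - move=> z /=; rewrite (Ik _ (cyc_d n z)).2 linearB /=.
    by rewrite -[in RHS]cm_comm.
  by exists (g', h) => z; have [] := gh z.
have gd n x :
    (s n).1 (cpx_d Q (n + 1) n x) = cpx_d X (n + 1) n ((s (n + 1)).1 x).
  by have [] := sC n x.
exists (mk_chain_map gd), (fun n => (s n).2) => n x /=.
have [_ /eqP] := sC n x; rewrite subr_eq => /eqP ->.
by rewrite -[X in X - _]addrA [X in X - _]addrC addrK.
Qed.

End Lifting.

(** * Connected maps in the derived category *)

Section Connectivity.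
Context {R : pzRingType}.
Implicit Types X Y Z : complex R.

Lemma map_connected_deq k X Y (p q : dmor X Y) :
  deq p q -> map_connected k p -> map_connected k q.
Proof.
move=> /dhmap_deq pq [p_bij p_surj]; split=> [j jk|h].
  by apply: (eq_bij (p_bij j jk)) => x; exact: pq.
by have [g <-] := p_surj h; exists g; rewrite pq.
Qed.

Lemma map_connected_comp k X Y Z (q : dmor Y Z) (p : dmor X Y) :
  map_connected k q -> map_connected k p -> map_connected k (dcomp q p).
Proof.
move=> [q_bij q_surj] [p_bij p_surj]; split=> [j jk|h].
  exact: (bij_comp (q_bij j jk) (p_bij j jk)).
by have [g <-] := q_surj h; have [f <-] := p_surj g; exists f.
Qed.

Lemma quasi_iso_map_connected k X Y (s : chain_map X Y) :
  quasi_iso s -> map_connected k (dmap s).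
Proof. by move=> /quasi_isoP ls; apply/map_connectedP => n _; exact: ls. Qed.

End Connectivity.

(** * Derived morphisms out of a bounded below complex of projectives *)

Section ProjectiveSource.
Context {R : pzRingType} (Q : complex R) (a : int).
Hypothesis Q_proj : forall n, projective (Q n).
Hypothesis Q_bnd : forall n : int, n < a -> forall x : Q n, x = 0.
Implicit Types X Y Z : complex R.

Lemma lift_quasi_iso X Y (s : chain_map X Y) (f : chain_map Q Y) :
  quasi_iso s -> exists g : chain_map Q X, homotopic f (chain_comp s g).
Proof.
move=> /quasi_isoP ls; apply: (lift_upto_homotopy _ Q_proj Q_bnd) => n.
by left; exact: ls.
Qed.

(** The given homotopy is a map [k] into [hpb s s]. Up to homotopy [k] lifts along the
    quasi-isomorphism [j] to the path object of [X], and the lift [G] joins [g] to [g']. *)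
Lemma quasi_iso_homotopic_inj X Y (s : chain_map X Y) (g g' : chain_map Q X) :
  quasi_iso s -> homotopic (chain_comp s g) (chain_comp s g') -> homotopic g g'.
Proof.
move=> qs /hpb_lift_exists[k [k1 k2]].
pose I := chain_id X; pose p1 := hpb_fst I I; pose p2 := hpb_snd I I.
have [j [j1 j2]] : exists j : chain_map (hpb I I) (hpb s s),
    (forall n x, hpb_fst s s n (j n x) = p1 n x) /\
    (forall n x, hpb_snd s s n (j n x) = p2 n x).
  exact/hpb_lift_exists/homotopic_compl/(hpb_homotopic I I).
have qj : quasi_iso j.
  by apply: (quasi_iso_cancel j1); apply: hpb_fst_qi => //; exact: quasi_iso_id.
have [G kG] := lift_quasi_iso k qj.
apply: (@homotopic_trans _ _ _ _ (chain_comp p1 G)).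
  apply: (@homotopic_trans _ _ _ _ (chain_comp (hpb_fst s s) k)).
    by apply: homotopic_ext => n x; exact/esym/k1.
  apply: homotopic_trans (homotopic_compl (hpb_fst s s) kG) _.
  by apply: homotopic_ext => n x; exact: j1.
apply: (@homotopic_trans _ _ _ _ (chain_comp p2 G)).
  exact: (homotopic_compr G (hpb_homotopic I I)).
apply: homotopic_sym.
apply: (@homotopic_trans _ _ _ _ (chain_comp (hpb_snd s s) k)).
  by apply: homotopic_ext => n x; exact/esym/k2.
apply: homotopic_trans (homotopic_compl (hpb_snd s s) kG) _.
by apply: homotopic_ext => n x; exact: j2.
Qed.

(** Precomposing with a chain map out of [Q] makes the induction go through: each formal inverse met
    on the way is absorbed by [lift_quasi_iso]. *)
Lemma dmor_dmap Y (q : dmor Q Y) : exists f, deq q (dmap f).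
Proof.
suff H X (p : dmor X Y) (f : chain_map Q X) :
    exists g, deq (dcomp p (dmap f)) (dmap g).
  by have [g e] := H Q q (chain_id Q); exists g; rewrite -e deq_idr.
elim: p f => {X Y q} [X Y g f|X Y s qs f|X Y Z q IHq p IHp f].
- by exists (chain_comp g f); rewrite deq_map.
- have [g /homotopic_deq e] := lift_quasi_iso f qs; exists g.
  by rewrite e deq_map deq_assoc deq_invl deq_idl.
- have [g e] := IHp f; have [h e'] := IHq g; exists h.
  by rewrite -deq_assoc e e'.
Qed.

(* The action of a formal fraction on homotopy classes of maps out of [Q], as a
   relation: [deq]-invariance of this action detects homotopy. *)
Fixpoint dact X Y (p : dmor X Y) : chain_map Q X -> chain_map Q Y -> Prop :=
  match p in dmor X Y return chain_map Q X -> chain_map Q Y -> Prop with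
  | dmap _ _ u => fun f g => homotopic (chain_comp u f) g
  | dinv _ _ s _ => fun f g => homotopic f (chain_comp s g)
  | dcomp _ _ _ q p => fun f g => exists2 m, dact p f m & dact q m g
  end.

Lemma dact_homotopic X Y (p : dmor X Y) f f' g g' :
  homotopic f f' -> homotopic g g' -> dact p f g -> dact p f' g'.
Proof.
elim: p f f' g g' =>
  {X Y} [X Y u|X Y s qs|X Y Z q IHq p IHp] f f' g g' ff gg /=.
- move=> fg; apply: homotopic_trans gg; apply: homotopic_trans fg.
  exact/homotopic_sym/homotopic_compl.
- move=> fg; apply: homotopic_trans (homotopic_sym ff) _.
  by apply: homotopic_trans fg _; exact: homotopic_compl.
- move=> [m fm mg]; exists m.
    by apply: IHp fm => //; exact: homotopic_refl.
  by apply: IHq mg => //; exact: homotopic_refl.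
Qed.

(** Only the two cancellation relations rely on [Q] being projective and bounded below: [deq_invr]
    on the existence of lifts, [deq_invl] on their uniqueness up to homotopy. *)
Lemma dact_deq X Y (p q : dmor X Y) :
  deq p q -> forall f g, dact p f g <-> dact q f g.
Proof.
have hr := homotopic_refl.
elim=> {X Y p q} /=.
- by [].
- by move=> X Y p q _ H f g; rewrite H.
- by move=> X Y p q r _ H1 _ H2 f g; rewrite H1 H2.
- move=> X Y Z q q' p p' _ Hq _ Hp f g.
  by split=> -[m /Hp fm /Hq mg]; exists m.
- move=> W X Y Z r q p f g; split.
    by move=> [n [m fm mn] ng]; exists m => //; exists n.
  by move=> [m fm [n mn ng]]; exists n => //; exists m.
- move=> X Y p f g; split=> [[m fm mg]|fg]; last by exists g => //; exact: hr.
  by apply: dact_homotopic fm; [exact: hr | exact: mg].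
- move=> X Y p f g; split=> [[m fm mg]|fg]; last by exists f => //; exact: hr.
  by apply: dact_homotopic mg; [apply: homotopic_sym; exact: fm | exact: hr].
- move=> X Y u v uv f g.
  have e : homotopic (chain_comp u f) (chain_comp v f).
    by apply: homotopic_ext => n x; exact: uv.
  by split; apply: homotopic_trans => //; exact: homotopic_sym.
- move=> X Y Z v u f g; split=> [fg|[m fm mg]].
    by exists (chain_comp u f); [exact: hr | exact: fg].
  by apply: homotopic_trans mg; apply: (homotopic_compl v fm).
- move=> X Y s qs f g; split=> [[m fm mg]|fg].
    by apply: (quasi_iso_homotopic_inj qs); exact: homotopic_trans mg.
  by exists (chain_comp s f); [exact: hr | exact: (homotopic_compl s fg)].
- move=> X Y s qs f g; split=> [[m fm mg]|fg].
    by apply: homotopic_trans mg; exact: fm.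
  have [m fm] := lift_quasi_iso f qs; exists m => //.
  by apply: homotopic_trans (homotopic_sym fm) _; exact: fg.
Qed.

(** Invariance of the action is tested on the identity of [Q]. *)
Lemma deq_homotopic Y (f g : chain_map Q Y) :
  deq (dmap f) (dmap g) -> homotopic f g.
Proof.
move=> /dact_deq/(_ (chain_id Q) f)[+ _] => /(_ (homotopic_refl _)) fg.
by apply: homotopic_sym; exact: fg.
Qed.

(** With [p] written as the fraction of [t] by [s], the chain map [t] inherits connectedness from
    [p], and the chain map [phi] representing [f] lifts along [t]. *)
Lemma projective_skeletal (b : int) :
  (forall n : int, b < n -> forall x : Q n, x = 0) -> skeletal b Q.
Proof.
move=> Q_bnd' X Y p cp f.
have [Z [s [qs [t pE]]]] := right_fraction p.
have {cp} /map_connectedP lt : map_connected b (dmap t).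
  have e : deq (dcomp p (dmap s)) (dmap t) by rewrite pE dinvK.
  apply: map_connected_deq e _; apply: map_connected_comp => //.
  exact: quasi_iso_map_connected.
have [phi fE] := dmor_dmap f.
have [|g /homotopic_deq phiE] :=
  @lift_upto_homotopy _ Q _ _ t a phi Q_proj Q_bnd.
  (* The fiber of [t] is known to be exact only below [b]; from [b] on, [Q (n + 1)] is zero. *)
  move=> n; have [nb|bn] := ltP n b; first by left; exact: lt.
  by right; apply: Q_bnd'; rewrite ltzD1.
exists (dmap (chain_comp s g)).
by rewrite pE deq_map deq_assoc dinvK fE phiE deq_map.
Qed.

End ProjectiveSource.

(** * Projective resolutions *)

Section Resolution.
Context {R : pzRingType} (A : complex R).

(* The part of a resolution [Q -> A] in degree [n] that the construction of the
   next degree depends on; [stage_d] is the differential leaving [Q n]. *)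
Record stage (n : int) := Stage {
  stage_mod : lmodType R;
  stage_tgt : lmodType R;
  stage_d : {linear stage_mod -> stage_tgt};
  stage_map : {linear stage_mod -> A n} }.

(** The second clause compares kernels, as [stage_tgt t'] is not identified with [stage_mod t]. The
    last clause is [lifts], with cycles read off [stage_d]. *)
Definition next_stage n (t : stage n) (t' : stage (n + 1))
    (d : {linear stage_mod t' -> stage_mod t}) : Prop :=
  [/\ forall x, stage_d t (d x) = 0,
      forall x, stage_d t' x = 0 <-> d x = 0,
      forall x, stage_map t (d x) = cpx_d A (n + 1) n (stage_map t' x) &
      forall w y, stage_d t w = 0 -> stage_map t w = cpx_d A (n + 1) n y ->
        exists x u, d x = w /\
          y = stage_map t' x + cpx_d A (n + 1 + 1) (n + 1) u].

(** A projective module is mapped onto [ker psi], the cycles of the fiber; the two coordinates are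
    the new differential and the new map to [A]. *)
Lemma next_stage_exists n (t : stage n) :
  (forall x, stage_d t x = 0 -> cyc (stage_map t x)) ->
  exists (t' : stage (n + 1)) (d : {linear stage_mod t' -> stage_mod t}),
    [/\ projective (stage_mod t'),
        forall x, stage_d t' x = 0 -> cyc (stage_map t' x) & next_stage d].
Proof.
move=> t_cyc.
pose psi :
    {linear prod (stage_mod t) (A (n + 1)) -> prod (stage_tgt t) (A n)} :=
  pair_lin (stage_d t \o fst)
           ((stage_map t \o fst) \- (cpx_d A (n + 1) n \o snd)).
have [P [e [pP e_surj]]] := enough_projectives (ker psi).
pose d : {linear P -> stage_mod t} := fst \o ker_incl psi \o e.
pose g : {linear P -> A (n + 1)} := snd \o ker_incl psi \o e.
have dg x : stage_d t (d x) = 0 /\ stage_map t (d x) = cpx_d A (n + 1) n (g x).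
  by case: (ker_valP (e x)) => -> /eqP; rewrite subr_eq0 => /eqP.
exists (Stage d g), d; split=> // [x dx|].
  by apply: cycS; rewrite -(dg x).2 [d x]dx linear0.
split=> //= [x|x|w y dw gw]; [exact: (dg x).1 | exact: (dg x).2 |].
have psi_wy : psi (w, y) = 0 by rewrite /= dw gw subrr.
have [x ex] := e_surj (mk_ker psi_wy).
by exists x, 0; rewrite linear0 addr0 /d /g /= ex.
Qed.

Lemma projective_zero : projective ('rV[R]_0 : lmodType R).
Proof.
move=> M N e f _; exists \0 => x.
by rewrite (_ : x = 0) ?linear0 //; apply/rowP => -[].
Qed.

Lemma projective_resolution (a : int) : connected (a - 1) A ->
  exists (Q : complex R) (rho : chain_map Q A),
    [/\ quasi_iso rho, forall n, projective (Q n) &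
        forall n : int, n < a -> forall x : Q n, x = 0].
Proof.
move=> /connectedP A_acyc.
pose T0 n : stage n := @Stage n 'rV[R]_0 'rV[R]_0 \0 \0.
have T0_eq0 n (x : stage_mod (T0 n)) : x = 0 by apply/rowP => -[].
pose I n (t : stage n) := [/\ projective (stage_mod t),
  forall x, stage_d t x = 0 -> cyc (stage_map t x) &
  n < a -> forall x : stage_mod t, x = 0].
pose C n (t : stage n) t' := exists d, @next_stage n t t' d.
have I0 n : I n (T0 n).
  split=> [|x _ j|_ x]; last exact: T0_eq0.
    exact: projective_zero.
  by rewrite linear0.
(* Zero stages are admissible below [a] because cycles of [A] are boundaries there. *)
have C0 n (t : stage n) : I n t -> n + 1 < a -> C n t (T0 (n + 1)).
  move=> [_ _ t0] na; exists \0; split=> [x|x|x|w y _] /=; rewrite ?linear0 //.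
  rewrite (t0 _ w); last by lia.
  rewrite linear0 => /esym dy; have [|u yE] := A_acyc (n + 1) _ y (cycS dy).
    by lia.
  by exists 0, u; rewrite add0r.
have [||n t It|s [sI sC]] := @int_dep_choice stage T0 I C (a - 1).
- by move=> n _; exact: I0.
- by move=> n na; apply: C0 => //; lia.
- have [na|na] := ltP (n + 1) a.
    by exists (T0 (n + 1)); split=> //; exact: C0.
  have [_ t_cyc _] := It.
  have [t' [d [pt' t'_cyc td]]] := next_stage_exists t_cyc.
  by exists t'; split; [split=> //; lia | exists d].
pose d n := sval (cid (sC n)).
have dP n : next_stage (d n) := svalP (cid (sC n)).
have dd n x : d n (d (n + 1) x) = 0.
  by have [_ H _ _] := dP n; apply/H; have [H' _ _ _] := dP (n + 1); exact: H'.
pose Q := mk_complex dd.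
have rho_d n x : stage_map (s n) (cpx_d Q (n + 1) n x) =
    cpx_d A (n + 1) n (stage_map (s (n + 1)) x).
  by rewrite mk_complexE; have [_ _ H _] := dP n; exact: H.
exists Q, (@mk_chain_map _ Q A (fun n => stage_map (s n)) rho_d); split.
- apply/quasi_isoP => n w y cw /= rw.
  have [_ _ _ /(_ w y)[|//|x [u [dx yE]]]] := dP n.
    have [m e] := int_succP n; subst n; have [_ H _ _] := dP m; apply/H.
    by have := cw m; rewrite mk_complexE.
  by exists x, u; rewrite mk_complexE.
- by move=> n; have [] := sI n.
- by move=> n na x; have [_ _ H] := sI n; exact: H.
Qed.

End Resolution.

(** * Subcomplexes cut out degreewise as kernels *)

Section KernelComplex.
Context {R : pzRingType} (Q : complex R) (pi : forall n, {linear Q n -> Q n}).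
Hypothesis pi_d : forall n x,
  pi (n + 1) x = 0 -> pi n (cpx_d Q (n + 1) n x) = 0.

Fact ker_cpx_dP n (x : ker (pi (n + 1))) :
  pi n ((cpx_d Q (n + 1) n \o ker_incl (pi (n + 1))) x) = 0.
Proof. exact/pi_d/ker_valP. Qed.

Fact ker_cpx_dd n (x : ker (pi (n + 1 + 1))) :
  ker_lift (@ker_cpx_dP n) (ker_lift (@ker_cpx_dP (n + 1)) x) = 0.
Proof. by apply: val_inj; rewrite /= cpx_dd. Qed.

(** The family [pi] is in general no chain map; its kernels are stable under the differential. Both
    [trunc] and [split_cpx] arise this way. *)
Definition ker_cpx : complex R := mk_complex ker_cpx_dd.

Lemma ker_cpx_dE n (x : ker_cpx (n + 1)) :
  ker_val (cpx_d ker_cpx (n + 1) n x) = cpx_d Q (n + 1) n (ker_val x).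
Proof. by rewrite mk_complexE. Qed.

Definition ker_cpx_incl : chain_map ker_cpx Q :=
  @mk_chain_map _ ker_cpx Q (fun n => ker_incl (pi n)) ker_cpx_dE.

Lemma ker_cpx_eq0 n : (forall x, pi n x = x) -> forall x : ker_cpx n, x = 0.
Proof. by move=> pi_id x; apply: val_inj; rewrite /= -[LHS]pi_id ker_valP. Qed.

(** For an idempotent, [idfun \- pi n] retracts [Q n] onto the kernel. *)
Lemma ker_cpx_projective n : (forall x, pi n (pi n x) = pi n x) ->
  projective (Q n) -> projective (ker_cpx n).
Proof.
move=> pi_idem; have H x : pi n ((idfun \- pi n) x) = 0.
  by rewrite /= linearB /= pi_idem subrr.
apply: (projective_retract (i := ker_incl (pi n)) (r := ker_lift H)) => x.
by apply: val_inj; rewrite /= ker_valP subr0.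
Qed.

End KernelComplex.

(** * Transfer of connectivity and skeletality in the derived category *)

Section Transfer.
Context {R : pzRingType}.
Implicit Types X Y : complex R.

Lemma skeletal_retract k X Y (i : dmor Y X) (r : dmor X Y) :
  deq (dcomp r i) (dmap (chain_id Y)) -> skeletal k X -> skeletal k Y.
Proof.
move=> ri skX V W p cp f; have [g e] := skX V W p cp (dcomp f r).
by exists (dcomp g i); rewrite deq_assoc e -deq_assoc ri deq_idr.
Qed.

(** [connected] concerns a chain map out of the zero complex, whereas [p] is a formal composite. The
    zero complex being projective, [p] after zero is represented by a chain map, necessarily
    zero. *)
Lemma connected_diso k X Y : diso X Y -> connected k X -> connected k Y.
Proof.
move=> [p [q [qp pq]]] cX.
have cp : map_connected k p.
  have qpE := dhmap_deq qp; have pqE := dhmap_deq pq.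
  split=> [j _|h]; last first.
    by exists (dhmap q k h); have := pqE k h; rewrite /= hmap_id.
  exists (dhmap q j) => h.
    by have := qpE j h; rewrite /= hmap_id.
  by have := pqE j h; rewrite /= hmap_id.
have Z0 n (x : @zero_complex R n) : x = 0 by apply/rowP => -[].
have [] := @dmor_dmap _ (@zero_complex R) 0 _ _ _
  (dcomp p (dmap (chain_zero _ X))).
- by move=> n; exact: projective_zero.
- by move=> n _ x; exact: Z0.
move=> f e; have e' : deq (dmap f) (dmap (chain_zero _ Y)).
  by apply: deq_ext => n x; rewrite (Z0 n x) !linear0.
apply: map_connected_deq (deq_trans e e') _; exact: map_connected_comp.
Qed.

Lemma quasi_iso_diso X Y (s : chain_map X Y) : quasi_iso s -> diso Y X.
Proof.
move=> qs; exists (dinv qs), (dmap s).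
by split; [exact: deq_invr | exact: deq_invl].
Qed.

End Transfer.

(** * Brutal truncation and the splitting in degree [b] *)

Section Truncation.
Context {R : pzRingType} (Q : complex R) (b : int).

(** Its kernel is [Q n] up to degree [b] and zero above, so the kernel complex is the brutal
    truncation. *)
Definition above n : {linear Q n -> Q n} :=
  if n <= b then (\0 : {linear Q n -> Q n}) else idfun.

Fact above_d n x : above (n + 1) x = 0 -> above n (cpx_d Q (n + 1) n x) = 0.
Proof.
rewrite /above; have [nb|nb] := leP n b; first by [].
by case: ifP => [|_ /= ->]; [lia | rewrite linear0].
Qed.

Definition trunc : complex R := ker_cpx above_d.
Definition trunc_incl : chain_map trunc Q := ker_cpx_incl above_d.

Lemma trunc_eq0 n (x : trunc n) : b < n -> ker_val x = 0.
Proof.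
move=> bn; rewrite -(ker_valP x).
have above_id y : y = above n y by rewrite /above leNgt bn.
exact: above_id.
Qed.

(** For [n < b] the truncation contains all of [Q (n + 1)], so [y] is its own lift. *)
Lemma trunc_incl_connected : map_connected b (dmap trunc_incl).
Proof.
apply/map_connectedP => n nb w y cw /= wE.
have y0 : above (n + 1) y = 0 by rewrite /above ifT //; lia.
exists (mk_ker y0), 0; split; last by rewrite linear0 addr0.
by apply: val_inj; rewrite /= ker_cpx_dE wE.
Qed.

(* If the identity of [Q] is homotopic, via [h], to a map factoring through
   [trunc], then [d h] is a projection of [Q b] onto the boundaries. Its kernel
   completes [Q] below degree [b] to a complex quasi-isomorphic to [Q]. *)
Section Split.
Variable gamma : chain_map Q trunc.
Variable h : forall n, {linear Q n -> Q (n + 1)}.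
Hypothesis hE : forall n x,
  chain_id Q (n + 1) x - chain_comp trunc_incl gamma (n + 1) x =
  cpx_d Q (n + 1 + 1) (n + 1) (h (n + 1) x) + h n (cpx_d Q (n + 1) n x).

(** In degree [n + 1 > b] the map through [trunc] vanishes, and the homotopy becomes a
    contraction. *)
Lemma split_contraction n x : b <= n ->
  x = cpx_d Q (n + 1 + 1) (n + 1) (h (n + 1) x) + h n (cpx_d Q (n + 1) n x).
Proof.
by move=> bn; rewrite -hE /= trunc_eq0 ?subr0 //; lia.
Qed.

Lemma split_dhd n x : b <= n ->
  cpx_d Q (n + 1) n (h n (cpx_d Q (n + 1) n x)) = cpx_d Q (n + 1) n x.
Proof.
by move=> bn; rewrite [in RHS](split_contraction x bn) linearD /= cpx_dd add0r.
Qed.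

Definition split_proj n : {linear Q n -> Q n} :=
  if n < b then (\0 : {linear Q n -> Q n})
  else if n == b then (cpx_d Q (n + 1) n \o h n : {linear Q n -> Q n})
  else idfun.

Variant split_proj_spec n : {linear Q n -> Q n} -> Prop :=
| SplitBelow of n < b : split_proj_spec (\0 : {linear Q n -> Q n})
| SplitAt of n = b : split_proj_spec (cpx_d Q (n + 1) n \o h n)
| SplitAbove of b < n : split_proj_spec idfun.

Lemma split_projP n : split_proj_spec (split_proj n).
Proof.
rewrite /split_proj; have [nb|bn|->] := ltgtP n b; [exact: SplitBelow| |].
  exact: SplitAbove.
exact: SplitAt.
Qed.

Fact split_proj_d n x :
  split_proj (n + 1) x = 0 -> split_proj n (cpx_d Q (n + 1) n x) = 0.
Proof.
case: (split_projP n) => // bn; case: (split_projP (n + 1)); try lia.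
  by move=> _ /= ->; rewrite !linear0.
by move=> _ /= ->; rewrite !linear0.
Qed.

Lemma split_proj_idem n x : split_proj n (split_proj n x) = split_proj n x.
Proof. by case: (split_projP n) => //= nb; rewrite split_dhd // nb. Qed.

Definition split_cpx : complex R := ker_cpx split_proj_d.
Definition split_incl : chain_map split_cpx Q := ker_cpx_incl split_proj_d.

Lemma split_cpx_eq0 n : b < n -> forall x : split_cpx n, x = 0.
Proof.
by move=> bn; apply: ker_cpx_eq0 => x; case: (split_projP n) => //; lia.
Qed.

Lemma split_incl_quasi_iso : quasi_iso split_incl.
Proof.
apply/quasi_isoP => n w y cw wE; rewrite /= in wE.
have [nb|bn] := ltP n b.
  (* Below [b], subtracting its projection moves [y] into the kernel; the projection is zero or,
     when [n + 1 = b], a boundary. *)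
  have H : split_proj (n + 1) (y - split_proj (n + 1) y) = 0.
    by rewrite linearB /= split_proj_idem subrr.
  have [u uE] : exists u, split_proj (n + 1) y = cpx_d Q (n + 1 + 1) (n + 1) u.
    case: (split_projP (n + 1)) => [_|_|]; last by lia.
      by exists 0; rewrite linear0.
    by exists (h (n + 1) y).
  exists (mk_ker H), u; rewrite /= -uE subrK; split=> //.
  by apply: val_inj; rewrite /= ker_cpx_dE /= uE linearB /= cpx_dd subr0.
(* In degree [b], [w] is a boundary, hence fixed by the projection that kills it. So [y] is a cycle,
   and the contraction bounds it. *)
have w0 : ker_val w = 0.
  have [e|bn'] := eqVneq n b; last by rewrite (split_cpx_eq0 _ w) //; lia.
  rewrite -(ker_valP w) wE; case: (split_projP n) => [|_|]; [lia | | lia].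
  by rewrite /= split_dhd.
exists 0, (h (n + 1) y); split.
  by rewrite linear0; apply: val_inj; rewrite /= w0.
by rewrite linear0 add0r {1}(split_contraction y bn) -wE w0 linear0 addr0.
Qed.

End Split.
End Truncation.

Theorem proposition7p2 (R : pzRingType) (a b : int) (A : complex R) :
  projective_amplitude a b A <-> connected (a - 1) A /\ skeletal b A.
Proof.
split=> [[P [pP P0 [p [q [qp pq]]]]]|[cA skA]].
  have Pa n : n < a -> forall x : P n, x = 0 by move=> na; apply: P0; left.
  split.
    apply: (@connected_diso _ _ P); first by exists q, p.
    by apply/connectedP => n na x _; exists 0; rewrite linear0; apply: Pa; lia.
  apply: (skeletal_retract qp); apply: (projective_skeletal pP Pa) => n bn.
  by apply: P0; right.
have [Q [rho [qrho pQ Q0]]] := projective_resolution cA.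
have skQ : skeletal b Q by apply: (skeletal_retract (deq_invl qrho)).
(* The only use of skeletality: the identity of [Q] lifts to the truncation. *)
have [g gE] := skQ _ _ _ (trunc_incl_connected Q b) (dmap (chain_id Q)).
have [gamma gammaE] := dmor_dmap pQ Q0 g.
(* Since [Q] is projective and bounded below, equality in the derived category yields an actual
   homotopy [h]. *)
have [|h hE] := deq_homotopic pQ Q0 (f := chain_id Q)
    (g := chain_comp (trunc_incl Q b) gamma).
  by rewrite -gE gammaE deq_map.
exists (split_cpx b h); split.
- by move=> n; apply: ker_cpx_projective => // x; exact: (split_proj_idem hE).
- move=> n [na|bn]; last exact: split_cpx_eq0.
  by move=> x; apply: val_inj; rewrite /= (Q0 n na (ker_val x)).
- exact: (quasi_iso_diso (quasi_iso_comp qrho (split_incl_quasi_iso hE))).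
Qed.
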